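(* Let $H$ be a graph with at least one edge. Then for all $n$ sufficiently large with respect to $H$, $$\mathcal{C}_H(K_n)=\begin{cases}\mathcal{C}(K_n) & \text{if } H \text{ is Eulerian and } |H| \text{ is odd},\\ \mathcal{C}(K_n)\cap\mathcal{D}(K_n) & \text{if } H \text{ is Eulerian and } |H| \text{ is even},\\ \mathcal{E}(K_n) & \text{if } H \text{ is not Eulerian and } |H| \text{ is odd},\\ \mathcal{D}(K_n) & \text{if } H \text{ is not Eulerian and } |H| \text{ is even}.\end{cases}$$
   Context: For a graph $G$, the edge space $\mathcal{E}(G)=\mathbb{F}_2^{E(G)}$ is identified with the set of spanning subgraphs (edge sets) of $G$, addition being symmetric difference. $\mathcal{C}(G)$ is the cycle space (subspace spanned by cycles of $G$); $\mathcal{C}_H(G)$ is the subspace spanned by the copies of $H$ in $G$; $\mathcal{D}(G)=\{D\in\mathcal{E}(G):|D|\equiv 0 \pmod 2\}$. $|H|$ denotes the number of edges of $H$. ''Eulerian'' means all degrees are even (the graph need not be connected). *)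

(* Defs.v *)
From mathcomp Require Import all_boot all_algebra.

Set Implicit Arguments.
Unset Strict Implicit.
Unset Printing Implicit Defensive.

Record sgraph := SGraph {
  vertex :> finType;
  adj : rel vertex;
  adj_sym : symmetric adj;
  adj_irr : irreflexive adj }.

Definition edges (G : sgraph) : {set {set G}} :=
  [set [set p.1; p.2] | p : G * G & adj p.1 p.2].

Definition num_edges (G : sgraph) : nat := #|edges G|.

Definition degree (G : sgraph) (x : G) : nat := #|[set y | adj x y]|.

(* Connectedness is not required. *)
Definition eulerian (G : sgraph) : bool := [forall x : G, ~~ odd (degree x)].

Definition edge (G : sgraph) := {e : {set G} | e \in edges G}.

(* The regular algebra ('F_2)^o carries the structure of vector space over 'F_2
   that makes this a vectType; it is convertible to 'F_2. *)
Definition edge_space (G : sgraph) := {ffun edge G -> ('F_2)^o}.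

Section EdgeSpace.

Variable G : sgraph.

Definition supp (D : edge_space G) : {set edge G} := [set e | D e != 0%R].

Definition edge_set (D : edge_space G) : {set {set G}} :=
  [set val e | e in supp D].

(* A copy of H in G is a not necessarily induced subgraph of G isomorphic to H,
   that is, the image of H under an injective homomorphism; it is recorded as
   the element of the edge space whose edges are the images of those of H. *)
Definition copies (H : sgraph) : {set edge_space G} :=
  [set D : edge_space G | [exists f : {ffun H -> G},
    [&& injectiveb f,
        [forall x, forall y, adj x y ==> adj (f x) (f y)]
      & edge_set D == [set f @: e | e : {set H} in edges H]]]].

Definition spanned (A : {set edge_space G}) : {set edge_space G} :=
  [set D | D \in <<enum A>>%VS].

Definition copy_space (H : sgraph) : {set edge_space G} := spanned (copies H).

Definition even_space : {set edge_space G} := [set D | ~~ odd #|supp D|].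

End EdgeSpace.

Section CompleteGraph.

Variable n : nat.

Definition complete_rel : rel 'I_n := fun x y => x != y.

Fact complete_sym : symmetric complete_rel.
Proof. by move=> x y; rewrite /complete_rel eq_sym. Qed.

Fact complete_irr : irreflexive complete_rel.
Proof. by move=> x; rewrite /complete_rel eqxx. Qed.

Definition complete_graph := SGraph complete_sym complete_irr.

End CompleteGraph.

Section CycleGraph.

Variable k : nat.

(* The first conjunct only matters for k = 1. *)
Definition cycle_rel : rel 'I_k :=
  fun x y => (x != y) && ((y == ordS x) || (x == ordS y)).

Fact cycle_sym : symmetric cycle_rel.
Proof. by move=> x y; rewrite /cycle_rel eq_sym orbC. Qed.

Fact cycle_irr : irreflexive cycle_rel.
Proof. by move=> x; rewrite /cycle_rel eqxx. Qed.

Definition cycle_graph := SGraph cycle_sym cycle_irr.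

End CycleGraph.

(* A cycle of G has at least 3 and at most #|G| vertices. *)
Definition cycles (G : sgraph) : {set edge_space G} :=
  \bigcup_(3 <= k < #|G|.+1) copies G (cycle_graph k).

Definition cycle_space (G : sgraph) : {set edge_space G} := spanned (cycles G).

(* Main.v *)
(** Let W be the span of the copies of H. If two embeddings of H differ by moving
    u to a fresh vertex, and two more are obtained from these by moving a
    neighbour v of u to another fresh vertex, then the sum of the four copies is
    a 4-cycle, since only the edge uv contributes; hence W contains all 4-cycles.
    Modulo the 4-cycles all triangles through a vertex o are equal, and a graph
    with even degrees is a sum of such triangles; so modulo W it is a multiple,
    given by the parity of its size, of a single triangle. If u has odd degree,
    then moving u alone gives all 2-edge paths in W, so that every graph is
    modulo W a multiple, again given by its parity, of a single edge. A copy of H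
    with |H| odd shows that this triangle or edge itself lies in W. *)

Require Import Defs.
From HB Require Import structures.
From mathcomp Require Import all_boot all_algebra.
From mathcomp Require Import perm action primitive_action alt.

Set Implicit Arguments.
Unset Strict Implicit.
Unset Printing Implicit Defensive.

Import GRing.Theory.

(** * The edge space over the two-element field, with parities of size and degree *)

Section Graphs.

Local Open Scope ring_scope.

Lemma F2_eq01 (a : 'F_2) : (a == 0) || (a == 1).
Proof. by case: a => [[|[|]]]. Qed.

Lemma F2_natr (n : nat) : (n%:R : 'F_2) = (odd n)%:R.
Proof. by apply/val_inj; rewrite /= !val_Fp_nat // !modn2 oddb. Qed.

Lemma F2_addvv (V : lmodType 'F_2) (v : V) : v + v = 0.
Proof. by rewrite -mulr2n -scaler_nat F2_natr scale0r. Qed.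

Lemma F2_oppv (V : lmodType 'F_2) (v : V) : - v = v.
Proof. by apply/esym/eqP; rewrite -addr_eq0 F2_addvv. Qed.

Lemma F2_mulvn (V : lmodType 'F_2) (v : V) (n : nat) : v *+ n = v *+ odd n.
Proof. by rewrite -scaler_nat F2_natr scaler_nat. Qed.

(* This is [0] when [s] is not an edge, in particular when [s] is a singleton. *)
Definition unit_vec (G : sgraph) (s : {set G}) : edge_space G :=
  [ffun e => (val e == s)%:R].

Definition copy_vec (H G : sgraph) (f : H -> G) : edge_space G :=
  \sum_(e in edges H) unit_vec (f @: e).

(* [P = predT] gives the parity of the number of edges, [P = (x \in _)] that of
   the degree of [x]. *)
Definition weight (G : sgraph) (P : pred {set G}) (D : edge_space G) : 'F_2 :=
  \sum_(e | P (val e)) D e.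

Section Weight.

Variable G : sgraph.
Implicit Types (D : edge_space G) (P : pred {set G}).

Lemma edge_space_sum D : D = \sum_e D e *: unit_vec (val e).
Proof.
apply/ffunP => e; rewrite sum_ffunE (bigD1 e) //= big1 => [|e' ne].
  by rewrite addr0 !ffunE eqxx [RHS]mulr1.
by rewrite !ffunE val_eqE eq_sym (negPf ne) [LHS]mulr0.
Qed.

Lemma weight_is_linear P : linear_for *%R (@weight G P).
Proof.
move=> a D D'; rewrite /weight mulr_sumr -big_split /=.
by apply: eq_bigr => e _; rewrite !ffunE.
Qed.

HB.instance Definition _ P :=
  GRing.isLinear.Build 'F_2 (edge_space G) 'F_2 *%R (@weight G P)
    (weight_is_linear P).

Lemma weight_unit_vec P (s : {set G}) :
  weight P (unit_vec s) = ((s \in edges G) && P s)%:R.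
Proof.
have [sG|sG] /= := boolP (s \in edges G); last first.
  by rewrite /weight big1 // => -[e eG] _; rewrite ffunE; case: eqP sG => // <-; rewrite eG.
rewrite /weight big_mkcond (bigD1 (Sub s sG)) //= big1 => [|e ne].
  by rewrite addr0 ffunE eqxx; case: (P s).
by rewrite ffunE -val_eqE /= in ne *; rewrite (negPf ne) if_same.
Qed.

Lemma weight_predT D : weight predT D = #|supp D|%:R.
Proof.
rewrite /weight (bigID (mem (supp D))) /= [X in _ + X]big1 => [|e]; last first.
  by rewrite inE negbK => /eqP.
rewrite addr0 -sum1_card natr_sum; apply: eq_bigr => e; rewrite inE => De0.
by case/orP: (F2_eq01 (D e)) De0 => /eqP-> //; rewrite eqxx.
Qed.

Lemma even_spaceE D : (D \in even_space G) = (weight predT D == 0).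
Proof. by rewrite inE weight_predT F2_natr; case: odd. Qed.

Lemma edge_setE D (e : edge G) : (val e \in edge_set D) = (D e != 0).
Proof. by rewrite mem_imset ?inE //; apply: val_inj. Qed.

Lemma edge_set_inj : injective (@edge_set G).
Proof.
move=> D D' eqD; apply/ffunP => e; have := edge_setE D e; rewrite eqD edge_setE.
by case/orP: (F2_eq01 (D e)) => /eqP->; case/orP: (F2_eq01 (D' e)) => /eqP->.
Qed.

(** Distinct members of [A] occupy distinct coordinates, so nothing cancels. The inclusion matters
    because a non-edge contributes 0. *)
Lemma edge_set_sum (A : {set {set G}}) :
  A \subset edges G -> edge_set (\sum_(s in A) unit_vec s : edge_space G) = A.
Proof.
move=> sAG; apply/setP => s; have [sG|sG] := boolP (s \in edges G); last first.
  rewrite (contraNF (subsetP sAG s)) //; apply/imsetP => -[[e eG] _ /= es].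
  by rewrite es eG in sG.
rewrite (edge_setE _ (Sub s sG)) sum_ffunE; under eq_bigr do rewrite ffunE /=.
have [sA|sA] := boolP (s \in A).
  rewrite (bigD1 s) //= big1 ?eqxx ?addr0 // => s' /andP[_ ne].
  by rewrite eq_sym (negPf ne).
rewrite big1 ?eqxx // => s' s'A; case: eqP => // es; by rewrite es s'A in sA.
Qed.

(** This yields the easy inclusion in every case: the parity of the size or of a degree need only be
    checked on generators. *)
Lemma weight_span P (A : {set edge_space G}) D :
  {in A, forall D', weight P D' = 0} -> D \in spanned A -> weight P D = 0.
Proof.
move=> A0; rewrite in_set => DA; rewrite (coord_span (X := in_tuple (enum A)) DA).
rewrite linear_sum big1 // => i _; rewrite linearZ /= A0 ?mulr0 //.
by rewrite -mem_enum mem_nth.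
Qed.

End Weight.

Lemma mem_edges (G : sgraph) (x y : G) : adj x y -> [set x; y] \in edges G.
Proof. by move=> xy; apply/imsetP; exists (x, y); rewrite ?inE. Qed.

Lemma edgesP (G : sgraph) (s : {set G}) :
  reflect (exists x y : G, adj x y /\ s = [set x; y]) (s \in edges G).
Proof.
apply: (iffP imsetP) => [[[x y]]|[x [y [xy ->]]]].
  by rewrite inE => xy ->; exists x, y.
by exists (x, y); rewrite ?inE.
Qed.

Lemma imset_edge (aT rT : finType) (f : aT -> rT) (x y : aT) :
  f @: [set x; y] = [set f x; f y].
Proof. by rewrite imsetU1 imset_set1. Qed.

Lemma edge_at (G : sgraph) (x : G) (s : {set G}) :
  s \in edges G -> x \in s -> exists2 y, adj x y & s = [set x; y].
Proof.
case/edgesP => y [z [yz ->]]; rewrite !inE => /orP[] /eqP->; first by exists z.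
by exists y; [rewrite adj_sym | rewrite setUC].
Qed.

Lemma degreeE (G : sgraph) (x : G) :
  degree x = #|[set s in edges G | x \in s]|.
Proof.
rewrite /degree -(card_in_imset (f := fun y => [set x; y])) => [|y z].
  apply: eq_card => s; rewrite !inE; apply/imsetP/andP => [[y]|[sG xs]].
    by rewrite inE => xy ->; rewrite mem_edges // !inE eqxx.
  by have [y xy ->] := edge_at sG xs; exists y; rewrite ?inE.
rewrite !inE => xy _ /setP /(_ y); rewrite !inE eqxx orbT => /esym /orP[] /eqP //.
by move=> yx; rewrite yx adj_irr in xy.
Qed.

(** * Copies of a graph in a complete graph *)

Section Complete.

Variables (n : nat) (H : sgraph).
Local Notation K := (complete_graph n).
Implicit Types f : H -> K.

Lemma copy_edge f (e : {set H}) :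
  injective f -> e \in edges H -> f @: e \in edges K.
Proof.
move=> f_inj /edgesP[x [y [xy ->]]]; rewrite imset_edge mem_edges //.
by rewrite /adj /= /complete_rel (inj_eq f_inj); apply: contraTneq xy => ->; rewrite adj_irr.
Qed.

(** Any injective map into a complete graph is a homomorphism, and over the two-element field a
    vector is determined by its support. *)
Lemma copiesP (D : edge_space K) :
  reflect (exists2 f : H -> K, injective f & D = copy_vec f) (D \in copies K H).
Proof.
have edge_copy f : injective f -> edge_set (copy_vec f) = [set f @: e | e : {set H} in edges H].
  move=> f_inj; rewrite /copy_vec -(big_imset (@unit_vec K)) /=; last first.
    by move=> e e' _ _; apply: imset_inj.
  by rewrite edge_set_sum //; apply/subsetP => s /imsetP[e eH ->]; apply: copy_edge.
rewrite inE; apply: (iffP existsP) => [[f /and3P[/injectiveP f_inj _ /eqP Df]]|[f f_inj ->]].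
  by exists f => //; apply: edge_set_inj; rewrite Df edge_copy.
have ff : finfun f =1 f by move=> x; rewrite ffunE.
exists (finfun f); apply/and3P; split.
- by apply/injectiveP => x y; rewrite !ff => /f_inj.
- apply/'forall_forallP => x y; apply/implyP => xy; rewrite !ff.
  by rewrite /adj /= /complete_rel (inj_eq f_inj); apply: contraTneq xy => ->; rewrite adj_irr.
- rewrite edge_copy //; apply/eqP; apply: eq_imset => e; exact/esym/eq_imset.
Qed.

Lemma weight_copy f (P : pred {set K}) : injective f ->
  weight P (copy_vec f) = #|[set e in edges H | P (f @: e)]|%:R.
Proof.
move=> f_inj; rewrite linear_sum -sum1_card natr_sum big_mkcond [RHS]big_mkcond /=.
apply: eq_bigr => e _; rewrite inE weight_unit_vec; case: ifP => //= eH.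
by rewrite copy_edge //=; case: ifP.
Qed.

Lemma weight_copy_size f : injective f ->
  weight predT (copy_vec f) = (num_edges H)%:R.
Proof.
by move=> f_inj; rewrite weight_copy //; congr _%:R; apply: eq_card => e; rewrite inE andbT.
Qed.

(** At [x = f u] the copy has the degree of [u] in [H]; off the image of [f] it has degree 0. *)
Lemma weight_copy_degree f x : injective f -> eulerian H ->
  weight (fun s => x \in s) (copy_vec f) = 0.
Proof.
move=> f_inj /forallP evenH; rewrite weight_copy //.
case: (boolP [exists u, f u == x]) => [/existsP[u /eqP <-]|nx].
  rewrite (eq_card (B := [set e in edges H | u \in e])) => [|e].
    by rewrite -degreeE F2_natr (negPf (evenH u)).
  by rewrite !inE mem_imset.
rewrite eq_card0 // => e; rewrite inE; apply: contraNF nx => /andP[_ /imsetP[u _ ->]].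
by apply/existsP; exists u.
Qed.

End Complete.

End Graphs.

(** The symmetric group on [T] is [#|T|]-transitive, hence k-transitive for every smaller k. *)
Lemma perm_of_seq (T : finType) (s t : seq T) :
  uniq s -> uniq t -> size s = size t -> exists p : {perm T}, map p s = t.
Proof.
move=> us ut st; have le_s : size s <= #|T| by rewrite -(card_uniqP us) max_card.
have dt (r : seq T) (rs : size r == size s) : uniq r -> Tuple rs \in dtuple_on (size s) [set: T].
  by move=> ur; rewrite inE /= ur; apply/subsetP => x; rewrite inE.
have ts : size t == size s by rewrite st.
have [p _ /(congr1 val) /= ->] :=
  atransP2 (ntransitive_weak le_s (Sym_trans T)) (dt _ (eqxx _) us) (dt _ ts ut).
by exists p.
Qed.

(** * Four-cycles and two-edge paths in the span of the copies *)

Section Spanning.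

Local Open Scope ring_scope.

Variables (n : nat) (H : sgraph).
Local Notation K := (complete_graph n).
Local Notation W := <<enum (copies K H)>>%VS.
Implicit Types (f : H -> K) (a b c d : K) (u v : H).

Lemma mem_copy_vec f : injective f -> copy_vec f \in W.
Proof. by move=> f_inj; rewrite memv_span // mem_enum; apply/copiesP; exists f. Qed.

(** The bound on [n] leaves two spare vertices, to which [u] and [v] can later be moved. A fixed
    embedding is composed with a permutation that carries the four relevant vertices to [a], [b],
    [c], [d]. *)
Lemma ex_embedding (u v : H) a b c d :
  (#|H| + 2 <= n)%N -> adj u v -> uniq [:: a; b; c; d] ->
  exists f : H -> K,
    [/\ injective f, f u = a, f v = c, forall x, f x != b & forall x, f x != d].
Proof.
move=> le_n uv abcd.
have lt_n (i : nat) : (i < 2 -> #|H| + i < n)%N.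
  by move=> i2; rewrite (leq_trans _ le_n) // -addnS leq_add2l.
(* [f0] occupies the vertices below [#|H|], and [y] supplies the next two. *)
pose f0 (x : H) : K := Ordinal (leq_trans (ltn_ord (enum_rank x)) (leq_trans (leq_addr 2 _) le_n)).
pose y i (i2 : (i < 2)%N) : K := Ordinal (lt_n i i2).
have f0_inj : injective f0 by move=> x x' /(congr1 val) /= /val_inj /enum_rank_inj.
have f0y x i (i2 : (i < 2)%N) : f0 x != y i i2.
  by rewrite -val_eqE /= neq_ltn (leq_trans (ltn_ord _)) ?leq_addr.
have uniq0 : uniq [:: f0 u; y 0%N isT; f0 v; y 1%N isT].
  rewrite /= !inE !negb_or !f0y 2!(eq_sym _ (f0 v)) f0y (inj_eq f0_inj) /=.
  rewrite -val_eqE /= eqn_add2l !andbT.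
  by apply: contraTneq uv => ->; rewrite adj_irr.
have [p [pu pb pv pd]] := perm_of_seq uniq0 abcd erefl.
exists (p \o f0); split=> // [|x|x] /=.
- by apply: inj_comp; [apply: perm_inj|].
- by rewrite -pb (inj_eq perm_inj).
- by rewrite -pd (inj_eq perm_inj).
Qed.

(** Only [u] is sent to [a] and nothing to [b], so the transposition is felt only by edges at
    [u]. *)
Lemma imset_tperm_notin f u a b (e : {set H}) :
  injective f -> f u = a -> (forall x, f x != b) -> u \notin e ->
  (tperm a b \o f) @: e = f @: e.
Proof.
move=> f_inj <- fb ue; apply: eq_in_imset => x xe /=; rewrite tpermD ?(eq_sym b) //.
by rewrite (inj_eq f_inj); apply: contraNneq ue => ->.
Qed.

Lemma mem_square a b c d :
  (0 < num_edges H)%N -> (#|H| + 2 <= n)%N -> uniq [:: a; b; c; d] ->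
  unit_vec [set a; c] + unit_vec [set b; c]
    + (unit_vec [set a; d] + unit_vec [set b; d]) \in W.
Proof.
move=> /card_gt0P[e0 /edgesP[u [v [uv _]]]] le_n abcd.
have [f [f_inj fu fv fb fd]] := ex_embedding le_n uv abcd.
have uDv : u != v by apply: contraTneq uv => ->; rewrite adj_irr.
move: abcd; rewrite /= !inE !negb_or.
move=> /andP[/and3P[aDb aDc aDd] /andP[/andP[bDc bDd] /andP[cDd _]]].
set p := tperm a b; set q := tperm c d.
have g_inj : injective (q \o f) by apply: inj_comp; [apply: perm_inj|].
have gu : (q \o f) u = a by rewrite /= fu /q tpermD // eq_sym.
have gb x : (q \o f) x != b.
  by rewrite /= -(inj_eq (@perm_inj _ q)) /q tpermK tpermD // eq_sym.
suff <- : copy_vec f + copy_vec (p \o f) + (copy_vec (q \o f) + copy_vec (p \o (q \o f)))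
  = unit_vec [set a; c] + unit_vec [set b; c]
    + (unit_vec [set a; d] + unit_vec [set b; d]).
  by rewrite !rpredD ?mem_copy_vec //; apply: inj_comp => //; apply: perm_inj.
rewrite -!big_split /= (bigD1 [set u; v]) ?mem_edges //= big1 => [|e /andP[eH ne]].
  have [qa pc pd] : [/\ q a = a, p c = c & p d = d].
    by split; rewrite /p /q tpermD // eq_sym.
  have [pa qc] : p a = b /\ q c = d by rewrite /p /q !tpermL.
  by rewrite !imset_edge addr0 /= fu fv qa qc pa pc pd.
(* An edge missing [u] is not affected by [p]: its four images cancel within the pairs that differ
   by [p]. *)
have [ue|ue] := boolP (u \in e); last first.
  by rewrite (imset_tperm_notin f_inj fu) // (imset_tperm_notin g_inj gu) // !F2_addvv.
(* An edge at [u] other than [uv] misses [v], so [q] does not affect it and the cancellation is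
   across the two pairs. *)
have ve : v \notin e.
  apply: contra ne => ve; have [w uw ew] := edge_at eH ue.
  by move: ve; rewrite ew !inE eq_sym (negPf uDv) /= => /eqP->.
have qe : (q \o f) @: e = f @: e by rewrite (imset_tperm_notin f_inj fv).
by rewrite [(p \o (q \o f)) @: e]imset_comp qe -imset_comp F2_addvv.
Qed.

(** Moving [u] from [a] to [b] changes a copy by one path [a - f w - b] for each neighbour [w] of
    [u]. Modulo squares the middle vertex is irrelevant, and an odd number of equal paths leaves
    one. *)
Lemma mem_cherry u a b c :
  odd (degree u) -> (#|H| + 2 <= n)%N -> uniq [:: a; b; c] ->
  unit_vec [set a; c] + unit_vec [set b; c] \in W.
Proof.
move=> odd_u le_n abc.
have [v] : exists v, v \in [set v | adj u v] by apply/card_gt0P; exact: odd_gt0.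
rewrite inE => uv.
have uDv : u != v by apply: contraTneq uv => ->; rewrite adj_irr.
(* A fourth vertex exists since [u] and [v] are distinct, whence [n] is at least 4. *)
have [d dabc] : exists d, d \notin [:: a; b; c].
  have: (0 < #|[predC [:: a; b; c]]|)%N; last by case/card_gt0P => d; exists d.
  have H2 : (2 <= #|H|)%N by rewrite (leq_trans _ (max_card [set u; v])) // cards2 uDv.
  rewrite -(ltn_add2l #|[:: a; b; c]|) cardC addn0 (card_uniqP abc) card_ord.
  by apply: leq_trans le_n; rewrite addn2.
have abcd : uniq [:: a; b; c; d].
  by rewrite -[_ :: _]/(rcons [:: a; b; c] d) rcons_uniq dabc.
have [f [f_inj fu fv fb _]] := ex_embedding le_n uv abcd.
set p := tperm a b.
have HK : (0 < num_edges H)%N by apply/card_gt0P; exists [set u; v]; apply: mem_edges.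
have pf_inj : injective (p \o f) by apply: inj_comp => //; apply: perm_inj.
have /(rpredD (mem_copy_vec f_inj)) := mem_copy_vec pf_inj.
rewrite -big_split /= (bigID (fun e : {set H} => u \in e)) /=.
rewrite [X in _ + X]big1 ?addr0 => [|e /andP[_ ue]]; last first.
  by rewrite (imset_tperm_notin f_inj fu) // F2_addvv.
set S := \sum_(_ in _ | _) _ => WS.
have : S - (unit_vec [set a; c] + unit_vec [set b; c]) *+ degree u \in W.
  rewrite degreeE -sumr_const.
  rewrite (eq_bigl (fun e => (e \in edges H) && (u \in e))) => [|e]; last by rewrite inE.
  rewrite -sumrB; apply: rpred_sum => e /andP[eH ue].
  have [w uw ->] := edge_at eH ue.
  have fwb := fb w; have fwa : f w != a.
    by rewrite -fu (inj_eq f_inj); apply: contraTneq uw => ->; rewrite adj_irr.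
  rewrite !imset_edge /= fu /p tpermL [tperm a b _]tpermD 1?eq_sym //.
  (* The path through [f w] either is the one through [c] or differs from it by a square. *)
  have [->|fwc] := eqVneq (f w) c; first by rewrite subrr rpred0.
  rewrite F2_oppv; apply: mem_square => //=.
  move: abc; rewrite /= !inE !negb_or andbT => /andP[/andP[aDb aDc] bDc].
  by rewrite aDb aDc bDc fwc (eq_sym a) (eq_sym b) fwa fwb.
by rewrite rpredBl // F2_mulvn odd_u.
Qed.

End Spanning.

(** * Reduction to a multiple of one edge or one triangle *)

Section Reduction.

Local Open Scope ring_scope.

(** Pairs sharing an element have congruent values, and [xy] is linked to [pq] through [xp]. It
    serves for edges, and for triangles at [o] indexed by the side opposite [o]. *)
Lemma symmetric_pair_const (T : eqType) (F : fieldType) (V : vectType F)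
    (W : {vspace V}) (P : pred T) (phi : T -> T -> V) :
  (forall x y, phi x y = phi y x) ->
  (forall x y z, P x -> P y -> P z -> uniq [:: x; y; z] -> phi x y - phi x z \in W) ->
  forall x y p q, P x -> P y -> P p -> P q -> x != y -> p != q ->
    phi x y - phi p q \in W.
Proof.
move=> phiC phiW.
have step x y z : P x -> P y -> P z -> x != y -> x != z -> phi x y - phi x z \in W.
  move=> Px Py Pz xy xz; have [->|yz] := eqVneq y z; first by rewrite subrr mem0v.
  by apply: phiW => //=; rewrite !inE negb_or xy xz yz.
move=> x y p q Px Py Pp Pq xy pq.
have [xp|xp] := eqVneq x p; first by rewrite xp in xy *; apply: step.
have := rpredD (step x y p Px Py Pp xy xp) (step p x q Pp Px Pq _ pq).
by rewrite eq_sym [phi p x]phiC addrA subrK => ->.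
Qed.

Variable n : nat.
Local Notation K := (complete_graph n).
Implicit Types (D : edge_space K) (W : {vspace edge_space K}).

Lemma edge_pair (e : edge K) : exists x y : K, x != y /\ val e = [set x; y].
Proof. by have /edgesP[x [y [xy ->]]] := valP e; exists x, y. Qed.

Lemma weight_total D : weight predT D = \sum_e D e.
Proof. exact: eq_bigl. Qed.

Lemma cherries_reduce W (p q : K) D :
  (forall a b c : K, uniq [:: a; b; c] ->
     unit_vec [set a; c] + unit_vec [set b; c] \in W) ->
  p != q -> D - weight predT D *: unit_vec [set p; q] \in W.
Proof.
move=> cherry pq; rewrite {1}(edge_space_sum D) weight_total scaler_suml -sumrB.
apply: rpred_sum => e _; rewrite -scalerBr memvZ //.
have [x [y [xy ->]]] := edge_pair e.
apply: (symmetric_pair_const (P := predT) (phi := fun x y => unit_vec [set x; y])) => //.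
  by move=> x' y'; rewrite setUC.
move=> a b c _ _ _ /=; rewrite !inE negb_or andbT => /andP[/andP[ab ac] bc].
rewrite F2_oppv 2!(setUC [set a]) cherry //= !inE negb_or bc (eq_sym b) (eq_sym c).
by rewrite ab ac.
Qed.

Definition triangle (o x y : K) : edge_space K :=
  unit_vec [set x; y] + (unit_vec [set o; x] + unit_vec [set o; y]).

(** This makes the degenerate [triangle o x y], with [x] or [y] equal to [o], vanish. *)
Lemma unit_vec1 (x : K) : unit_vec [set x; x] = 0 :> edge_space K.
Proof.
apply/ffunP => e; rewrite !ffunE; have [y [z [yz ->]]] := edge_pair e.
case: eqP => // /setP yzE; have := yzE y; have := yzE z.
by rewrite !inE !eqxx orbT !orbb => /esym/eqP zx /esym/eqP yx; rewrite yx zx eqxx in yz.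
Qed.

Lemma squares_reduce W (o p q : K) D :
  (forall a b c d : K, uniq [:: a; b; c; d] ->
     unit_vec [set a; c] + unit_vec [set b; c]
       + (unit_vec [set a; d] + unit_vec [set b; d]) \in W) ->
  uniq [:: o; p; q] ->
  (forall x : K, weight (fun s => x \in s) D = 0) ->
  D - weight predT D *: triangle o p q \in W.
Proof.
move=> square opq even_deg.
have triE x y : x != y ->
    unit_vec [set x; y] + \sum_(z in [set x; y]) unit_vec [set o; z] = triangle o x y.
  by move=> xy; rewrite big_setU1 ?inE ?xy //= big_set1.
(* The edge [ox] is counted once for each edge of [D] at [x], hence an even number of times. *)
have sum0 : \sum_(e : edge K) D e *: \sum_(z in val e) unit_vec [set o; z] = 0 :> edge_space K.
  under eq_bigr do rewrite scaler_sumr big_mkcond /=.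
  rewrite exchange_big big1 //= => x _; rewrite -big_mkcond /= -scaler_suml.
  by rewrite [X in X *: _]even_deg scale0r.
(* The degree of [o] is even, so dropping the edges at [o] preserves the parity of the size. *)
have sizeE : weight predT D = \sum_(e : edge K | o \notin val e) D e.
  rewrite weight_total (bigID (fun e : edge K => o \in val e)) /=.
  by rewrite [X in X + _]even_deg add0r.
(* Adding [sum0] edge by edge, [e] contributes the triangle on [o] and [e] if [o]
   is not in [e], and [0] otherwise. *)
rewrite -[X in X - _]addr0 -sum0 {1}(edge_space_sum D) -big_split /=.
rewrite (bigID (fun e : edge K => o \notin val e)) /= [X in _ + X - _]big1 => [|e]; last first.
  rewrite negbK; have [x [y [xy ->]]] := edge_pair e => oxy.
  rewrite -scalerDr triE // /triangle; move: oxy; rewrite !inE => /orP[] /eqP <-.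
    by rewrite unit_vec1 add0r F2_addvv scaler0.
  by rewrite unit_vec1 addr0 setUC F2_addvv scaler0.
rewrite addr0 sizeE scaler_suml -sumrB; apply: rpred_sum => e.
have [x [y [xy ->]]] := edge_pair e => oxy.
rewrite -scalerDr triE // -scalerBr memvZ //.
apply: (symmetric_pair_const (P := predC1 o) (phi := triangle o)).
- by move=> x' y'; rewrite /triangle setUC [X in _ + X]addrC.
(* Two triangles sharing the edge [oa] differ by the 4-cycle [a b o c]. *)
- move=> a b c ao bo co /=; rewrite !inE negb_or andbT => /andP[/andP[ab ac] bc].
  rewrite F2_oppv /triangle addrACA [X in _ + X]addrACA F2_addvv add0r addrACA.
  apply: square; move: ao bo co; rewrite /= !inE !negb_or => ao bo co.
  by rewrite ab ac bc ao !(eq_sym o) bo co.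
- by move: oxy; rewrite !inE negb_or eq_sym => /andP[].
- by move: oxy; rewrite !inE negb_or => /andP[_]; rewrite eq_sym.
- by move: opq; rewrite /= !inE negb_or eq_sym => /andP[/andP[]].
- by move: opq; rewrite /= !inE negb_or [q == o]eq_sym => /andP[/andP[]].
- by [].
- by move: opq; rewrite /= !inE => /and3P[].
Qed.

End Reduction.

(** * Degrees and size of cycle graphs *)

Section Cycles.

Variables (k : nat) (k_ge3 : 3 <= k).

(** As [k] is at least 3, it divides neither 1 nor 2. This keeps the two neighbours of a vertex
    distinct and the edges [{x, x + 1}] pairwise different. *)
Lemma ordS_neq (x : 'I_k) : (ordS x != x) && (ordS (ordS x) != x).
Proof.
have shift d : 0 < d < 3 -> (x + d) %% k != x.
  case/andP=> d0 d3; rewrite -[X in _ != X](modn_small (ltn_ord x)).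
  rewrite eqn_mod_dvd ?leq_addr // addKn gtnNdvd //; exact: leq_trans k_ge3.
rewrite -!val_eqE /= -addn1 shift //=.
by rewrite -addn1 modnDml -addnA shift.
Qed.

Lemma cycle_adjS (x : 'I_k) : @adj (cycle_graph k) x (ordS x).
Proof. by rewrite /adj /= /cycle_rel eqxx eq_sym; case/andP: (ordS_neq x) => ->. Qed.

Lemma eulerian_cycle : eulerian (cycle_graph k).
Proof.
apply/forallP => x; suff -> : degree x = 2 by [].
have [Sx SSx] := andP (ordS_neq x).
have SDpred : ordS x != ord_pred x by apply: contraNneq SSx => ->; rewrite ord_predK.
rewrite /degree (_ : [set y | adj x y] = [set ordS x; ord_pred x]) ?cards2 ?SDpred //.
apply/setP => y; rewrite !inE; apply/andP/orP => [[_ /orP]|xy].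
  by case=> /eqP->; [left | right; rewrite ordSK].
case: xy => /eqP->; split; rewrite ?ord_predK ?eqxx ?orbT //; first by rewrite eq_sym.
by apply: contraNneq Sx => {1}->; rewrite ord_predK.
Qed.

Lemma num_edges_cycle : num_edges (cycle_graph k) = k.
Proof.
rewrite /num_edges (_ : edges _ = [set [set x; ordS x : cycle_graph k] | x : cycle_graph k]).
  rewrite card_imset ?card_ord // => x y eq_xy.
  have: x \in [set y; ordS y] by rewrite -eq_xy !inE eqxx.
  have: y \in [set x; ordS x] by rewrite eq_xy !inE eqxx.
  rewrite !inE eq_sym; case: (eqVneq x y) => //= _ /eqP yx /eqP xy.
  by have /andP[_] := ordS_neq x; rewrite -yx -xy eqxx.
apply/setP => s; apply/edgesP/imsetP => [[x [y [/andP[_ xy] ->]]]|[x _ ->]].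
  by case/orP: xy => /eqP->; [exists x | exists y; rewrite // setUC].
by exists x, (ordS x); split=> //; apply: cycle_adjS.
Qed.

End Cycles.

(** * Copy spaces and the cycle space described by parities *)

Section CopySpaces.

Variable n : nat.
Local Notation K := (complete_graph n).

Definition all_degrees_even (D : edge_space K) : bool :=
  [forall x : K, weight (fun s : {set K} => x \in s) D == 0%R].

Section OneGraph.

Variables (H : sgraph) (H_edge : 0 < num_edges H) (n_ge3 : 3 <= n)
  (n_big : #|H| + 2 <= n).

Lemma copy_space_even D :
  D \in copy_space K H -> ~~ odd (num_edges H) -> weight predT D = 0%R.
Proof.
move=> DH evenH; apply: weight_span DH => _ /copiesP[f f_inj ->].
by rewrite weight_copy_size // F2_natr (negPf evenH).
Qed.

Lemma copies_degrees_even D :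
  eulerian H -> D \in copies K H -> all_degrees_even D.
Proof.
by move=> eH /copiesP[f f_inj ->]; apply/forallP => x; rewrite weight_copy_degree.
Qed.

(** If [H] has odd size, a copy [h] has weight 1, so [h] and [h - t] in the span put [t] there, and
    with it [D]. If [D] has weight 0, the multiple of [t] disappears. *)
Lemma mem_copy_space D (t : edge_space K) :
  (forall h, h \in copies K H -> h - weight predT h *: t \in <<enum (copies K H)>>%VS)%R ->
  (D - weight predT D *: t \in <<enum (copies K H)>>%VS)%R ->
  odd (num_edges H) || (weight predT D == 0%R) -> D \in copy_space K H.
Proof.
move=> ht Dt; rewrite in_set; case/orP => [oddH|/eqP D0]; last first.
  by rewrite D0 scale0r subr0 in Dt.
have [f f_inj] : exists f : H -> K, injective f.
  have le : #|H| <= n by apply: leq_trans (leq_addr _ _) n_big.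
  by exists (fun u => widen_ord le (enum_rank u)) => u v /(congr1 val) /= /val_inj /enum_rank_inj.
have fH : copy_vec f \in copies K H by apply/copiesP; exists f.
have := ht _ fH; rewrite weight_copy_size // F2_natr oddH scale1r.
rewrite rpredBl; last by rewrite memv_span ?mem_enum.
by move=> tW; rewrite rpredBr // memvZ // in Dt.
Qed.

Lemma eulerian_copy_space : eulerian H ->
  copy_space K H =
    [set D | all_degrees_even D & odd (num_edges H) || (weight predT D == 0%R)].
Proof.
move=> eH; apply/setP => D; rewrite [RHS]inE; apply/idP/andP => [DH|[De Do]].
  split; last by case: (boolP (odd _)) => //= /(copy_space_even DH) ->.
  apply/forallP => x; apply/eqP; apply: weight_span DH => h hH.
  by have /forallP/(_ x)/eqP := copies_degrees_even eH hH.
pose o : K := Ordinal (ltn_trans (isT : 0 < 2) n_ge3).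
pose p : K := Ordinal (ltn_trans (isT : 1 < 2) n_ge3).
pose q : K := Ordinal n_ge3.
have opq : uniq [:: o; p; q] by [].
have red h : all_degrees_even h ->
    (h - weight predT h *: triangle o p q \in <<enum (copies K H)>>%VS)%R.
  move=> /forallP he; apply: squares_reduce => // [a b c d|x]; last exact/eqP.
  exact: mem_square.
apply: (mem_copy_space (t := triangle o p q)) => // [h hH|]; last exact: red.
exact/red/copies_degrees_even.
Qed.

Lemma noneulerian_copy_space : ~~ eulerian H ->
  copy_space K H = [set D | odd (num_edges H) || (weight predT D == 0%R)].
Proof.
move=> /forallPn[u /negbNE odd_u]; apply/setP => D; rewrite [RHS]inE.
apply/idP/idP => [DH|Do].
  by case: (boolP (odd _)) => //= /(copy_space_even DH) ->.
pose p : K := Ordinal (ltn_trans (isT : 0 < 2) n_ge3).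
pose q : K := Ordinal n_ge3.
have red h : (h - weight predT h *: unit_vec [set p; q] \in <<enum (copies K H)>>%VS)%R.
  by apply: cherries_reduce => // a b c; apply: (mem_cherry odd_u).
exact: mem_copy_space Do.
Qed.

End OneGraph.

(** Since 3 is odd, the Eulerian case for the triangle imposes no condition on the size: triangles
    alone span all graphs with even degrees. The bound 5 is three vertices plus two spare ones. *)
Lemma cycle_spaceE : 5 <= n -> cycle_space K = [set D | all_degrees_even D].
Proof.
move=> n5; have n3 : 3 <= n by apply: leq_trans n5.
apply/setP => D; rewrite [RHS]inE; apply/idP/idP => [DC|De].
  have cycles_even h : h \in cycles K -> all_degrees_even h.
    rewrite /cycles big_seq; elim/big_ind: _ => [|A B IHA IHB|k]; first by rewrite inE.
      by rewrite inE => /orP[/IHA | /IHB].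
    rewrite mem_index_iota => /andP[k3 _].
    exact/copies_degrees_even/eulerian_cycle.
  apply/forallP => x; apply/eqP; apply: weight_span DC => h /cycles_even.
  by move=> /forallP /(_ x) /eqP.
have : D \in copy_space K (cycle_graph 3).
  rewrite eulerian_copy_space ?num_edges_cycle ?card_ord ?eulerian_cycle //.
  by rewrite inE De.
rewrite !in_set; apply/subvP; apply: sub_span => h; rewrite !mem_enum => hC.
have K_gt3 : 3 < #|K|.+1 by rewrite card_ord; exact: leqW (ltnW n5).
by rewrite /cycles big_ltn // inE hC.
Qed.

End CopySpaces.

Theorem theorem1p5 (H : sgraph) (H_edge : 0 < num_edges H) :
  exists N : nat, forall n : nat, N <= n ->
    copy_space (complete_graph n) H =
      if eulerian H then
        if odd (num_edges H) then cycle_space (complete_graph n)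
        else cycle_space (complete_graph n) :&: even_space (complete_graph n)
      else
        if odd (num_edges H) then [set: edge_space (complete_graph n)]
        else even_space (complete_graph n).
Proof.
(* The summand 5 meets the bound of [cycle_spaceE] whatever [H] is, and covers the two spare
   vertices. *)
exists (#|H| + 5) => n n_big.
have n5 : 5 <= n by apply: leq_trans n_big; apply: leq_addl.
have n3 : 3 <= n by apply: leq_trans n5.
have nH : #|H| + 2 <= n by apply: leq_trans n_big; rewrite leq_add2l.
have [eH|neH] := boolP (eulerian H).
  rewrite eulerian_copy_space // cycle_spaceE //.
  by case: ifP => oddH; apply/setP => D; rewrite !(in_setI, even_spaceE, in_set) ?andbT.
rewrite noneulerian_copy_space //.
by case: ifP => oddH; apply/setP => D; rewrite inE ?even_spaceE ?inE.
Qed.
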